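(* For constants $a,b,p$ put $A=A(u,a,b)=b+au^2+u^4$ and $$H_p=\frac{A^{1/2}-u^2+p}{A^{1/2}}\left(d\varphi^2+A^{-1/2}\,du^2\right)-\frac{u\left((a+2u^2)-2A^{1/2}\right)}{2\left(A^{1/2}-u^2+p\right)}\cos\varphi .$$ If $b=0$, $a=1$, $p=0$, then the Hamiltonian $H_p$, where $\varphi\in[0,2\pi)$ and $u\in[0,+\infty)$, defines a conservative system on $S^2$, corresponding to the case of Kovalevskaya.
   Context: Let $M$ be a Riemannian manifold and $U:M\to\mathbb R$ a smooth function. Identifying $TM$ and $T^*M$ by means of the Riemannian metric, one gets the Hamiltonian system on $T^*M$ with Hamiltonian $H=\frac12\sum g^{ij}(q)p_ip_j+U(q)=K+U$; such Hamiltonian systems are called conservative systems on $M$. Here the Hamiltonian (total energy) is written as a sum of a quadratic form in the differentials of the coordinates, which represents the kinetic part (the Riemannian metric), and a function, which is the potential. The case of Kovalevskaya (in the dynamics of a rigid body) is the conservative system on $S^2$ with total energy (Hamiltonian) $$H=\frac{du_1^2+du_2^2+2du_3^2}{2u_1^2+2u_2^2+u_3^2}-u_1,$$ where $S^2$ is given by $u_1^2+u_2^2+u_3^2=1$. It possesses an integral of fourth degree in momenta. *)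

(* Defs.v *)
From HB Require Import structures.
From mathcomp Require Import all_boot all_order all_algebra.
From mathcomp Require Import all_classical all_reals all_analysis.

Set Implicit Arguments.
Unset Strict Implicit.
Unset Printing Implicit Defensive.

Import Order.TTheory GRing.Theory Num.Theory.
Import numFieldNormedType.Exports.

Local Open Scope classical_set_scope.
Local Open Scope ring_scope.

Fixpoint Ck (R : realType) (V W : normedModType R) (k : nat) (O : set V)
    (f : V -> W) : Prop :=
  if k is k'.+1 then
    (forall x, O x -> differentiable f x) /\ (forall v, Ck k' O ('D_v f))
  else forall x, O x -> {for x, continuous f}.

Definition smooth_on (R : realType) (V W : normedModType R) (O : set V)
    (f : V -> W) : Prop :=
  forall k, Ck k O f.

Section Sphere.
Variable R : realType.
Implicit Types (q v : 'rV[R]_3) (g : 'M[R]_3).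

Definition bil g v (w : 'rV[R]_3) : R := (v *m g *m w^T) 0 0.

Definition sphere : set 'rV[R]_3 :=
  [set q | q 0 0 ^+ 2 + q 0 1 ^+ 2 + q 0 2 ^+ 2 = 1].

Definition tangent q : set 'rV[R]_3 := [set v | (q *m v^T) 0 0 = 0].

(* Smooth maps, functions and metrics on S^2 are represented by smooth
   extensions to a neighbourhood of S^2 in R^3; such extensions always exist,
   and the definitions below only use them through their restriction to S^2
   and, for metrics and differentials, to tangent vectors of S^2. *)
Definition smooth_near_sphere (W : normedModType R) (f : 'rV[R]_3 -> W) :
    Prop :=
  exists O : set 'rV[R]_3, [/\ open O, sphere `<=` O & smooth_on O f].

Record system := System {
  metric : 'rV[R]_3 -> 'M[R]_3;
  potential : 'rV[R]_3 -> R
}.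

Definition conservative (S : system) : Prop :=
  [/\ smooth_near_sphere (metric S),
      smooth_near_sphere (potential S),
      forall q, sphere q -> (metric S q)^T = metric S q
    & forall q v, sphere q -> tangent q v -> v != 0 ->
        0 < bil (metric S q) v v].

(* H = K + U at the covector bil (metric S q) v, where the tangent vector v
   stands for a covector under the identification of TM with T*M. *)
Definition hamiltonian (S : system) q v : R :=
  2^-1 * bil (metric S q) v v + potential S q.

Definition sphere_diffeo (F : 'rV[R]_3 -> 'rV[R]_3) : Prop :=
  exists G : 'rV[R]_3 -> 'rV[R]_3,
    [/\ smooth_near_sphere F, smooth_near_sphere G,
        forall q, sphere q -> sphere (F q) /\ G (F q) = q
      & forall q, sphere q -> sphere (G q) /\ F (G q) = q].

(* The cotangent lift of a diffeomorphism F carries the Hamiltonian of S to a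
   positive constant multiple of that of S'. The premise on v and v' says that
   the covector of v' at F q is the image of the covector of v at q. *)
Definition corresponds (S S' : system) : Prop :=
  exists (F : 'rV[R]_3 -> 'rV[R]_3) (c : R),
    [/\ 0 < c, sphere_diffeo F
      & forall q v v', sphere q -> tangent q v -> tangent (F q) v' ->
          (forall w, tangent q w ->
             bil (metric S' (F q)) v' ('D_w F q) = bil (metric S q) v w) ->
          hamiltonian S q v = c * hamiltonian S' (F q) v'].

(* u_1, u_2, u_3 are q 0 0, q 0 1, q 0 2. *)
Definition kovalevskaya : system := System
  (fun q => (2 * q 0 0 ^+ 2 + 2 * q 0 1 ^+ 2 + q 0 2 ^+ 2)^-1 *:
     diag_mx (\row_(i < 3) (if i == 2 then 2 else 1)))
  (fun q => - q 0 0).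

(* A point x of the half-plane of coordinates has phi = x 0 0 and u = x 0 1;
   ds2 x w is the quadratic form in the differentials at x, evaluated at
   dphi = w 0 0 and du = w 0 1. *)
Record coord_system := CoordSystem {
  ds2 : 'rV[R]_2 -> 'rV[R]_2 -> R;
  coord_potential : 'rV[R]_2 -> R
}.

Definition pt (phi u : R) : 'rV[R]_2 :=
  \row_(i < 2) (if i == 0 then phi else u).

Definition strip : set 'rV[R]_2 :=
  [set x | 0 <= x 0 0 < 2 * pi /\ 0 <= x 0 1].

(* S is written as H in the coordinates (phi, u), 0 <= phi < 2 pi, 0 <= u.
   When u = 0 is a circle of S^2 and u = +oo a point, the coordinates cover
   only a closed disc; the sphere consists of two copies P true, P false of
   it, glued by the identity along u = 0. H is compared with S for u > 0, as
   its coefficients may be singular at u = 0; this determines S, the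
   metric and the potential of S being continuous. *)
Definition defines_on_sphere (H : coord_system) (S : system) : Prop :=
  exists (P : bool -> 'rV[R]_2 -> 'rV[R]_3) (pole : bool -> 'rV[R]_3),
    [/\ forall e, {within [set x : 'rV[R]_2 | 0 <= x 0 1], continuous (P e)} /\
                  smooth_on [set x : 'rV[R]_2 | 0 < x 0 1] (P e),
        forall e phi (u : R), 0 <= u ->
          P e (pt (phi + 2 * pi) u) = P e (pt phi u),
        forall e phi, P e (pt phi u) @[u --> +oo] --> pole e,
        [/\ forall e x y, strip x -> strip y -> P e x = P e y -> x = y,
            forall x y, strip x -> strip y ->
              (P true x = P false y <-> x = y /\ x 0 1 = 0),
            pole true <> pole false,
            forall e e' x, strip x -> P e x <> pole e'
          & forall q, sphere q <->
              (exists e, q = pole e) \/ (exists e x, strip x /\ q = P e x)]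
      & forall e (x : 'rV[R]_2), 0 < x 0 1 ->
          (forall w, bil (metric S (P e x)) ('D_w (P e) x) ('D_w (P e) x) =
                     ds2 H x w) /\
          potential S (P e x) = coord_potential H x].

Definition quartic (a b u : R) : R := b + a * u ^+ 2 + u ^+ 4.

Definition Hp (a b p : R) : coord_system := CoordSystem
  (fun x w =>
     let u := x 0 1 in
     let rA := Num.sqrt (quartic a b u) in
     (rA - u ^+ 2 + p) / rA * (w 0 0 ^+ 2 + rA^-1 * w 0 1 ^+ 2))
  (fun x =>
     let u := x 0 1 in
     let rA := Num.sqrt (quartic a b u) in
     - (u * ((a + 2 * u ^+ 2) - 2 * rA) / (2 * (rA - u ^+ 2 + p))
        * cos (x 0 0))).

End Sphere.

Arguments kovalevskaya : clear implicits.

(* Main.v *)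
(* With r = sqrt (1 + u^2) - u, a bijection from [0, +oo) to (0, 1], the metric
   of H_p at (a, b, p) = (1, 0, 0) becomes 2 r^2 / (1 + r^2) dphi^2
   + 2 / (1 - r^2) dr^2 and its potential - (r / 2) cos phi. In the coordinates
   u_1 = r cos phi, u_2 = r sin phi, u_3 = +- sqrt (1 - r^2) of the two closed
   hemispheres this is twice the Kovalevskaya metric and half its potential, so
   H_p is half the Kovalevskaya Hamiltonian under the covector map v' = 2 v. *)

Require Import Defs.
From mathcomp Require Import all_boot all_order all_algebra.
From mathcomp Require Import all_classical all_reals all_analysis.
From mathcomp Require Import ring lra.
Import Order.TTheory GRing.Theory Num.Theory.
Import numFieldNormedType.Exports.
Local Open Scope classical_set_scope.
Local Open Scope ring_scope.

Set Implicit Arguments.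
Unset Strict Implicit.
Unset Printing Implicit Defensive.

(** The zero linear map leaves no remainder near [x], so it is the differential. This makes
    differentiability at a point of an open set depend only on the values there. *)
Lemma differentiable_near0 (R : realType) (V W : normedModType R)
    (f : V -> W) (x : V) :
  (\forall y \near x, f y = 0) -> differentiable f x.
Proof.
move=> f0; have fx0 := nbhs_singleton f0.
have fo : f \o shift x = cst (f x) + (0 : V -> W) +o_ 0 id.
  apply/eqaddoP => e /= e0.
  move: f0; rewrite (near_shift 0) /= => f0.
  near=> y.
  rewrite !fctE /= fx0.
  have -> : f (y + x) = 0.
    have : f (y + (x - 0)) = 0 by near: y; apply: f0.
    by rewrite subr0.
  by rewrite addr0 subrr normr0 mulr_ge0 // ltW.
have c0 : continuous (0 : V -> W) by exact: cst_continuous.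
have E := @diff_unique R V W f (\0 : {linear V -> W}) x c0 fo.
apply/diff_locallyP; rewrite E; split => //.
Unshelve. all: by end_near. Qed.

(** * Calculus of C^k maps *)

Section CkTheory.
Variables (R : realType) (V : normedModType R) (O : set V).
Hypothesis openO : open O.
Implicit Types W : normedModType R.

Lemma near_open (P : V -> Prop) x :
  O x -> (forall y, O y -> P y) -> \forall y \near x, P y.
Proof.
by move=> Ox OP; apply: (@filterS _ _ _ _ _ OP); apply: open_nbhs_nbhs.
Qed.

Lemma eq_differentiable W (f g : V -> W) x :
  O x -> {in O, f =1 g} -> differentiable f x -> differentiable g x.
Proof.
move=> Ox fg df; have -> : g = f + (g - f) by rewrite addrC subrK.
apply: differentiableD => //; apply: differentiable_near0.
by apply: near_open => // y Oy; rewrite !fctE fg ?subrr// inE.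
Qed.

Lemma eq_derive W (f g : V -> W) x v :
  O x -> {in O, f =1 g} -> 'D_v f x = 'D_v g x.
Proof.
move=> Ox fg; apply: near_eq_derive.
by apply: near_open => // y Oy; rewrite fg// inE.
Qed.

(** Derivatives are known only through formulas valid on [O]; as [O] is open, such formulas may
    replace the actual derivatives at every order. *)
Lemma eq_Ck W k (f g : V -> W) : {in O, f =1 g} -> Ck k O f -> Ck k O g.
Proof.
elim: k f g => [|k IH] f g fg /=.
  move=> cf x Ox; have fgx : {near x, f =1 g}.
    by apply: near_open => // y Oy; rewrite fg// inE.
  change (g @ x --> g x); rewrite -(fg x) ?inE//.
  by apply: cvg_trans (cf x Ox); exact: near_eq_cvg.
move=> [df Df]; split=> [x Ox|v]; first exact: eq_differentiable fg (df x Ox).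
apply: IH (Df v) => x; rewrite inE => Ox; exact: eq_derive.
Qed.

Lemma CkW W k (f : V -> W) : Ck k.+1 O f -> Ck k O f.
Proof.
elim: k f => [|k IH] f [df Df].
  by move=> x Ox; apply/differentiable_continuous/df.
by split=> // v; apply: IH.
Qed.

Lemma CkS W k (f : V -> W) (g : V -> V -> W) :
  (forall x, O x -> differentiable f x) ->
  (forall v x, O x -> 'D_v f x = g v x) ->
  (forall v, Ck k O (g v)) -> Ck k.+1 O f.
Proof.
move=> df Df Cg; split=> // v; apply: eq_Ck (Cg v) => x; rewrite inE => Ox.
by rewrite Df.
Qed.

Lemma Ck_cst W k (c : W) : Ck k O (cst c).
Proof.
elim: k c => [|k IH] c /=; first by move=> x _; exact: cst_continuous.
apply: (@CkS _ _ _ (fun _ => cst 0)) => //.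
  by move=> v x _; rewrite derive_cst.
Qed.

Lemma CkD W k (f g : V -> W) : Ck k O f -> Ck k O g -> Ck k O (f + g).
Proof.
elim: k f g => [|k IH] f g /=.
  by move=> cf cg x Ox; apply: continuousD; [exact: cf|exact: cg].
move=> [df Df] [dg Dg]; apply: (@CkS _ _ _ (fun v => 'D_v f + 'D_v g)).
- by move=> x Ox; apply: differentiableD; [exact: df|exact: dg].
- by move=> v x Ox; rewrite deriveD//; apply: diff_derivable;
    [exact: df|exact: dg].
- by move=> v; apply: (IH).
Qed.

Lemma CkM k (f g : V -> R) : Ck k O f -> Ck k O g -> Ck k O (f * g).
Proof.
elim: k f g => [|k IH] f g.
  by move=> cf cg x Ox; apply: continuousM; [exact: cf|exact: cg].
move=> Cf Cg; have [[df Df] [dg Dg]] := (Cf, Cg).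
apply: (@CkS _ _ _ (fun v => f * 'D_v g + g * 'D_v f)).
- by move=> x Ox; apply: differentiableM; [exact: df|exact: dg].
- by move=> v x Ox; apply: deriveM; apply: diff_derivable;
    [exact: df|exact: dg].
- move=> v; apply: CkD; apply: IH; do ?[exact: Df|exact: Dg].
    exact: CkW Cf.
  exact: CkW Cg.
Qed.

Lemma CkZl W k (f : V -> R) (c : W) :
  Ck k O f -> Ck k O (fun x => f x *: c).
Proof.
elim: k f => [|k IH] f.
  by move=> cf x Ox; exact: (@continuousZr_tmp _ _ _ f c x (cf x Ox)).
move=> [df Df]; apply: (@CkS _ _ _ (fun v x => 'D_v f x *: c)).
- by move=> x Ox; apply: differentiableZl; exact: df.
- move=> v x Ox; rewrite deriveE; last by apply: differentiableZl; exact: df.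
  by rewrite diffZl ?deriveE//; exact: df.
- by move=> v; exact: IH (Df v).
Qed.

Lemma derive_comp1 (h : R -> R) (f : V -> R) x v dh :
  differentiable f x -> is_derive (f x) 1 h dh ->
  differentiable (h \o f) x /\ 'D_v (h \o f) x = dh * 'D_v f x.
Proof.
move=> df [dhf dhE].
have dhd : differentiable h (f x) by apply/derivable1_diffP.
have dc : differentiable (h \o f) x by apply: differentiable_comp.
split=> //; rewrite !deriveE// diff_comp//= deriv1E// derive1E dhE.
by rewrite mulrC.
Qed.

(** The derivative of [h] is required only at values taken by [f] on [O], which keeps away from the
    singularities of the inverse and the square root. Asking that [dh \o f] be of class C^k allows
    induction on [k] when [dh] is expressed through [h] itself. *)
Lemma Ck_comp k (h dh : R -> R) (f : V -> R) :
  (forall x, O x -> is_derive (f x) 1 h (dh (f x))) ->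
  Ck k.+1 O f -> Ck k O (dh \o f) -> Ck k.+1 O (h \o f).
Proof.
move=> hh Cf Cdh; have [df Df] := Cf.
apply: (@CkS _ _ _ (fun v => (dh \o f) * 'D_v f)).
- by move=> x Ox; have [] := derive_comp1 0 (df x Ox) (hh x Ox).
- by move=> v x Ox; have [_] := derive_comp1 v (df x Ox) (hh x Ox).
- by move=> v; exact: CkM Cdh (Df v).
Qed.

Lemma CkV k (f : V -> R) : (forall x, O x -> f x != 0) ->
  Ck k O f -> Ck k O (GRing.inv \o f).
Proof.
move=> f0; elim: k => [|k IH] Cf.
  by move=> x Ox; apply: (@continuousV _ _ f); [exact: f0|exact: Cf].
apply: (@Ck_comp _ _ (fun y => - y ^- 2)) => //.
  move=> x Ox; split; first exact: derivableV (f0 x Ox) _.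
  by rewrite (@deriveV _ _ id) ?f0// derive_id /GRing.scale/= mulr1.
have -> : (fun y => - y ^- 2) \o f =
    cst (-1) * ((GRing.inv \o f) * (GRing.inv \o f)).
  by apply/funext => x; rewrite !fctE/= mulN1r expr2 invfM.
apply: CkM; first exact: Ck_cst.
by apply: CkM; apply: IH; exact: CkW.
Qed.

Lemma Ck_sqrt k (f : V -> R) : (forall x, O x -> 0 < f x) ->
  Ck k O f -> Ck k O (Num.sqrt \o f).
Proof.
move=> f0; elim: k => [|k IH] Cf.
  move=> x Ox; apply: continuous_comp; [exact: Cf|exact: sqrt_continuous].
apply: (@Ck_comp _ _ (fun y => (2 * Num.sqrt y)^-1)) => //.
  by move=> x Ox; apply: is_derive1_sqrt; exact: f0.
apply: (@CkV _ (fun x => 2 * Num.sqrt (f x))).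
  by move=> x Ox; rewrite mulf_neq0// gt_eqF// sqrtr_gt0 f0.
apply: (@CkM _ (cst 2) (Num.sqrt \o f)); first exact: Ck_cst.
by apply: IH; exact: CkW.
Qed.

(** Cosine and sine are treated jointly because each is, up to sign, the derivative of the other. *)
Lemma Ck_cos_sin k (f : V -> R) :
  Ck k O f -> Ck k O (cos \o f) /\ Ck k O (sin \o f).
Proof.
elim: k => [|k IH] Cf.
  by split=> x Ox; apply: continuous_comp;
    do ?[exact: Cf|exact: continuous_cos|exact: continuous_sin].
have [Ccos Csin] := IH (CkW Cf); split.
  apply: (@Ck_comp _ _ (fun y => - sin y)) => //.
  have -> : (fun y => - sin y) \o f = cst (-1) * (sin \o f).
    by apply/funext => x; rewrite !fctE/= mulN1r.
  by apply: CkM => //; exact: Ck_cst.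
exact: (@Ck_comp _ _ cos).
Qed.

End CkTheory.

(** * Angles in [0, 2 pi) and points of the unit circle *)

Section Angle.
Variable R : realType.
Implicit Types x y c s : R.

Lemma cos_sin_inj x y : 0 <= x < 2 * pi -> 0 <= y < 2 * pi ->
  cos x = cos y -> sin x = sin y -> x = y.
Proof.
wlog le_yx : x y / y <= x.
  move=> wl xb yb cxy sxy; have [/wl|/ltW/wl] := leP y x; first exact.
  by move=> h; apply/esym/h.
move=> /andP[x0 x2] /andP[y0 y2] cxy sxy.
have cd : cos (x - y) = 1 by rewrite cosB cxy sxy -!expr2 cos2Dsin2.
have pi0 : 0 < pi :> R := pi_gt0 R.
have [dpi|dpi] := leP (x - y) pi.
  have : x - y = 0; last by lra.
  by apply: cos_inj; rewrite ?cos0// in_itv/=; apply/andP; split; lra.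
(* The reflected angle 2 pi - (x - y) lies in [0, pi] and has cosine 1, so it would vanish, against
   x - y < 2 pi. *)
have : pi *+ 2 - (x - y) = 0; last by lra.
apply: cos_inj; rewrite ?in_itv/=; do ?[by apply/andP; split; lra].
by rewrite addrC cosD2pi cosN cd cos0.
Qed.

Lemma exists_angle c s : c ^+ 2 + s ^+ 2 = 1 ->
  exists2 x, 0 <= x < 2 * pi & c = cos x /\ s = sin x.
Proof.
move=> cs1; have pi0 : 0 < pi :> R := pi_gt0 R.
have c1 : -1 <= c <= 1 by apply/andP; split; nra.
have sE : Num.sqrt (1 - c ^+ 2) = `|s|.
  by rewrite (_ : 1 - c ^+ 2 = s ^+ 2) ?sqrtr_sqr//; lra.
have ca : cos (acos c) = c by apply: acosK; rewrite in_itv.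
have sa : sin (acos c) = `|s| by rewrite sin_acos.
have a0 := acos_ge0 c1; have api := acos_lepi c1.
have [s0|s0] := leP 0 s.
  exists (acos c); first by apply/andP; split; lra.
  by rewrite ca sa ger0_norm.
(* For s < 0 the angle is 2 pi - acos c, which is below 2 pi only if acos c > 0; c = 1 would force s
   = 0. *)
have a1 : 0 < acos c.
  apply: acos_gt0; case/andP: c1 => -> /= c1.
  by rewrite lt_neqAle c1 andbT; apply/eqP; nra.
exists (- acos c + pi *+ 2); first by apply/andP; split; lra.
by rewrite cosD2pi sinD2pi cosN sinN ca sa ltr0_norm// opprK.
Qed.

End Angle.

(** * The radius r = sqrt (1 + u^2) - u *)

Section Radius.
Variable R : realType.
Implicit Types u r : R.

Definition disc_radius u := Num.sqrt (1 + u ^+ 2) - u.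

Lemma sqrt1D_gt0 u : 0 < Num.sqrt (1 + u ^+ 2).
Proof. by rewrite sqrtr_gt0; nra. Qed.

Lemma sqr_sqrt1D u : Num.sqrt (1 + u ^+ 2) ^+ 2 = 1 + u ^+ 2.
Proof. by rewrite sqr_sqrtr//; nra. Qed.

Lemma disc_radius_gt0 u : 0 < disc_radius u.
Proof.
rewrite /disc_radius; have := sqrt1D_gt0 u; have := sqr_sqrt1D u.
by set s := Num.sqrt _ => ? ?; nra.
Qed.

(** The radius is the positive root of r^2 + 2 u r = 1. This polynomial relation replaces the square
    root in later computations and gives u = (1 - r^2) / (2 r). *)
Lemma onemX2_disc_radius u : 1 - disc_radius u ^+ 2 = 2 * u * disc_radius u.
Proof.
have := sqr_sqrt1D u; rewrite /disc_radius.
by set s := Num.sqrt _ => ?; nra.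
Qed.

Lemma disc_radius_inj : injective disc_radius.
Proof.
move=> u v uv; have := onemX2_disc_radius u; have := onemX2_disc_radius v.
have := disc_radius_gt0 v; rewrite uv; set r := disc_radius v => r0 ->.
by move/(mulIf (lt0r_neq0 r0)) => h; lra.
Qed.

Lemma disc_radius0 : disc_radius 0 = 1.
Proof. by rewrite /disc_radius expr0n/= addr0 sqrtr1 subr0. Qed.

Lemma disc_radius_surj r : 0 < r <= 1 -> exists2 u, 0 <= u & disc_radius u = r.
Proof.
move=> /andP[r0 r1]; exists (2^-1 * (r^-1 - r)).
  have : 1 <= r^-1 by rewrite invf_ge1.
  lra.
rewrite /disc_radius.
(* For u = (1/r - r) / 2, obtained by solving 1 - r^2 = 2 u r, the radicand is a perfect square. *)
have -> : 1 + (2^-1 * (r^-1 - r)) ^+ 2 = (2^-1 * (r^-1 + r)) ^+ 2.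
  by field; rewrite gt_eqF.
rewrite sqrtr_sqr ger0_norm; first by field; rewrite gt_eqF.
by rewrite mulr_ge0// addr_ge0 ?invr_ge0// ltW.
Qed.

Lemma continuous_disc_radius : continuous disc_radius.
Proof.
move=> u; apply: (@continuousB _ _ _ (fun u => Num.sqrt (1 + u ^+ 2)) id) => //.
apply: (@continuous_comp _ _ _ (fun u => 1 + u ^+ 2) Num.sqrt).
  by apply: cvgD; [exact: cvg_cst|exact: exprn_continuous].
exact: sqrt_continuous.
Qed.

Lemma is_derive_disc_radius u :
  is_derive u 1 disc_radius (- disc_radius u / Num.sqrt (1 + u ^+ 2)).
Proof.
have s0 := sqrt1D_gt0 u.
have d1 : is_derive u 1 (fun u => 1 + u ^+ 2) (2 * u).
  apply: is_derive_eq; rewrite add0r /GRing.scale/=; ring.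
have d2 : is_derive (1 + u ^+ 2) 1 Num.sqrt (2 * Num.sqrt (1 + u ^+ 2))^-1.
  by apply: is_derive1_sqrt; nra.
have d3 := @is_derive1_comp _ Num.sqrt (fun u => 1 + u ^+ 2) u _ _ d2 d1.
have -> : disc_radius = (Num.sqrt \o (fun u => 1 + u ^+ 2)) - id.
  by apply/funext.
apply: (is_derive_eq (is_deriveB d3 (is_derive_id u 1))).
rewrite !fctE /=; field; rewrite gt_eqF//.
Qed.

(** From r (sqrt (1 + u^2) + u) = 1 one gets r u < 1, so r < e as soon as u > 1/e. *)
Lemma disc_radius_cvg0 : disc_radius u @[u --> +oo] --> (0 : R).
Proof.
apply/cvgrPdist_lt => e e0; near=> u.
have u0 : e^-1 < u by near: u; apply: nbhs_pinfty_gt; exact: num_real.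
rewrite sub0r normrN gtr0_norm ?disc_radius_gt0//.
have : disc_radius u * (Num.sqrt (1 + u ^+ 2) + u) = 1.
  by rewrite /disc_radius; have := sqr_sqrt1D u; set s := Num.sqrt _ => ?; nra.
have := disc_radius_gt0 u; have := sqrt1D_gt0 u; set s := Num.sqrt _.
have : e * e^-1 = 1 by rewrite mulfV// gt_eqF.
have : 0 < e^-1 by rewrite invr_gt0.
set i := e^-1; set r := disc_radius u => i0 ei s0 r0 E.
rewrite ltNge; apply/negP => er.
have iu : e * i < e * u by rewrite ltr_pM2l.
have eu : e * u <= r * u by rewrite ler_pM2r// (lt_trans i0).
by nra.
Unshelve. all: by end_near. Qed.

End Radius.
Arguments disc_radius {R} u.

(** * Coordinates in R^3 and the Kovalevskaya metric *)

Section Vec3.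
Variable R : realType.
Implicit Types q v w : 'rV[R]_3.

Definition vec3 (a b c : R) : 'rV[R]_3 := \row_(i < 3) nth 0 [:: a; b; c] i.

Lemma vec3_0 a b c : vec3 a b c 0 0 = a. Proof. by rewrite mxE. Qed.
Lemma vec3_1 a b c : vec3 a b c 0 1 = b. Proof. by rewrite mxE. Qed.
Lemma vec3_2 a b c : vec3 a b c 0 2 = c. Proof. by rewrite mxE. Qed.

Lemma ord3P (P : 'I_3 -> Prop) : P 0 -> P 1 -> P 2 -> forall i, P i.
Proof.
move=> P0 P1 P2 [[|[|[|//]]] i3]; [move: P0|move: P1|move: P2];
  by congr P; apply: val_inj.
Qed.

Lemma sum3E (F : 'I_3 -> R) : \sum_i F i = F 0 + F 1 + F 2.
Proof.
rewrite 3!big_ord_recl big_ord0 addr0 addrA.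
by congr (F _ + F _ + F _); apply: val_inj.
Qed.

Lemma rV3P q v : q 0 0 = v 0 0 -> q 0 1 = v 0 1 -> q 0 2 = v 0 2 -> q = v.
Proof. by move=> q0 q1 q2; apply/rowP; exact: ord3P. Qed.

(** Expansion in the standard basis reduces limits and C^k regularity of vectors to those of scalar
    coordinates. *)
Lemma vec3E a b c : vec3 a b c =
  a *: vec3 1 0 0 + b *: vec3 0 1 0 + c *: vec3 0 0 1.
Proof. by apply: rV3P; rewrite !mxE/= ?mulr0 ?mulr1 ?addr0 ?add0r. Qed.

Lemma vec3_cvg (T : Type) (F : set_system T) {FF : Filter F}
    (f g h : T -> R) a b c :
  f @ F --> a -> g @ F --> b -> h @ F --> c ->
  vec3 (f x) (g x) (h x) @[x --> F] --> vec3 a b c.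
Proof.
move=> fa gb hc; under eq_fun do rewrite vec3E; rewrite (vec3E a b c).
by apply: cvgD; [apply: cvgD|]; apply: cvgZr_tmp.
Qed.

Lemma Ck_vec3 (V : normedModType R) (O : set V) k (f g h : V -> R) : open O ->
  Ck k O f -> Ck k O g -> Ck k O h -> Ck k O (fun x => vec3 (f x) (g x) (h x)).
Proof.
move=> oO Cf Cg Ch; under eq_fun do rewrite vec3E.
apply: (CkD oO (f := fun x => f x *: vec3 1 0 0 + g x *: vec3 0 1 0));
  last exact: CkZl.
apply: (CkD oO (f := fun x => f x *: vec3 1 0 0)); exact: CkZl.
Qed.

Lemma derive_coord m n (M v : 'M[R]_(m, n)) i j :
  'D_v (fun N : 'M[R]_(m, n) => N i j) M = v i j.
Proof.
have := @derive_id R ('M[R]_(m, n) : normedModType R) M v.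
rewrite derive_mx; last exact: derivable_id.
by move=> /matrixP/(_ i j); rewrite mxE.
Qed.

(** All directional derivatives are constant, so C^(k+1) holds without induction, and one degree is
    then dropped. *)
Lemma Ck_coord m n (O : set 'M[R]_(m, n)) k i j : open O ->
  Ck k O (fun N : 'M[R]_(m, n) => N i j).
Proof.
move=> oO; apply: CkW.
apply: (CkS oO (g := fun t => cst (t i j))).
- by move=> N _; exact: differentiable_coord.
- by move=> v N _; rewrite derive_coord.
- by move=> v; exact: Ck_cst.
Qed.

Lemma Ck_id (V : normedModType R) (O : set V) k : open O -> Ck k O (@id V).
Proof.
move=> oO; apply: CkW; apply: (CkS oO (g := fun t => cst t)).
- by move=> x _; exact: ex_diff.
- by move=> v x _; rewrite derive_id.
- by move=> v; exact: Ck_cst.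
Qed.

Definition koval_den q := 2 * q 0 0 ^+ 2 + 2 * q 0 1 ^+ 2 + q 0 2 ^+ 2.

Lemma bil_koval q v w : bil (metric (kovalevskaya R) q) v w =
  (koval_den q)^-1 * (v 0 0 * w 0 0 + v 0 1 * w 0 1 + 2 * (v 0 2 * w 0 2)).
Proof.
rewrite /bil mxE sum3E !mxE !sum3E !mxE /= -/(koval_den q).
ring.
Qed.

Lemma Ck_koval_den (O : set 'rV[R]_3) k : open O -> Ck k O koval_den.
Proof.
move=> oO; have Csq j : Ck k O (fun q => q 0 j ^+ 2).
  exact: (CkM oO (Ck_coord _ _ _ oO) (Ck_coord _ _ _ oO)).
have C2 := Ck_cst oO k (2 : R).
exact: (CkD oO (CkD oO (CkM oO C2 (Csq 0)) (CkM oO C2 (Csq 1))) (Csq 2)).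
Qed.

(** On the sphere the denominator equals 2 - u_3^2, which is at least 1. *)
Lemma koval_den_gt0 q : sphere q -> 0 < koval_den q.
Proof. by rewrite /sphere/koval_den/= => ?; nra. Qed.

(** This set is the neighbourhood of the sphere on which the metric is extended smoothly. *)
Lemma open_koval_den : open [set q | 0 < koval_den q].
Proof.
apply: (@open_comp _ _ koval_den [set r | 0 < r]); last exact: open_gt.
by move=> q _; exact: (@Ck_koval_den setT 0 openT).
Qed.

End Vec3.

(** * The charts of the two hemispheres *)

Section Chart.
Variable R : realType.
Implicit Types (q v : 'rV[R]_3) (x y w : 'rV[R]_2) (e : bool).

Definition height (u : R) := Num.sqrt (1 - disc_radius u ^+ 2).

(** The value [e = false] gives the hemisphere u_3 >= 0 and [e = true] the hemisphere u_3 <= 0; u =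
    0 is the equator. *)
Definition chart e x : 'rV[R]_3 :=
  vec3 (disc_radius (x 0 1) * cos (x 0 0)) (disc_radius (x 0 1) * sin (x 0 0))
       ((-1) ^+ e * height (x 0 1)).

Definition pole e : 'rV[R]_3 := vec3 0 0 ((-1) ^+ e).

Lemma pt_0 (phi u : R) : pt phi u 0 0 = phi. Proof. by rewrite mxE. Qed.
Lemma pt_1 (phi u : R) : pt phi u 0 1 = u. Proof. by rewrite mxE. Qed.

Lemma rV2P x y : x 0 0 = y 0 0 -> x 0 1 = y 0 1 -> x = y.
Proof.
move=> e0 e1; apply/rowP => -[[|[|//]] i2].
  by rewrite (_ : Ordinal i2 = 0) //; apply: val_inj.
by rewrite (_ : Ordinal i2 = 1) //; apply: val_inj.
Qed.

Lemma sqr_height u : 0 <= u -> height u ^+ 2 = 1 - disc_radius u ^+ 2.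
Proof.
move=> u0; rewrite sqr_sqrtr// onemX2_disc_radius.
by have := disc_radius_gt0 u; nra.
Qed.

Lemma height_gt0 u : 0 < u -> 0 < height u.
Proof.
move=> u0; rewrite sqrtr_gt0 onemX2_disc_radius.
by have := disc_radius_gt0 u; nra.
Qed.

Lemma height0 : height 0 = 0.
Proof. by rewrite /height disc_radius0 expr1n subrr sqrtr0. Qed.

(** Continuity extends to u < 0, where the radicand is negative, because [Num.sqrt] is continuous on
    the whole line with value 0 on negative numbers. *)
Lemma continuous_height : continuous height.
Proof.
move=> u; apply: (@continuous_comp _ _ _ (fun u => 1 - disc_radius u ^+ 2)
    Num.sqrt).
  apply: cvgB; first exact: cvg_cst.
  apply: (@continuous_comp _ _ _ _ (fun r : R => r ^+ 2)).
    exact: continuous_disc_radius.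
  exact: exprn_continuous.
exact: sqrt_continuous.
Qed.

Lemma height_cvg1 : height u @[u --> +oo] --> (1 : R).
Proof.
apply: (@cvg_comp _ _ _ (fun u => 1 - disc_radius u ^+ 2) Num.sqrt
  _ (nbhs (1 : R))).
  have -> : nbhs (1 : R) = nbhs (1 - 0 ^+ 2 : R) by rewrite expr0n subr0.
  apply: cvgB; first exact: cvg_cst.
  apply: (@cvg_comp _ _ _ _ (fun r : R => r ^+ 2)).
    exact: disc_radius_cvg0.
  exact: exprn_continuous.
by have := @sqrt_continuous R 1; rewrite /continuous_at sqrtr1.
Qed.

Lemma is_derive_height (u : R) : 0 < u ->
  is_derive u 1 height
    (disc_radius u ^+ 2 / (Num.sqrt (1 + u ^+ 2) * height u)).
Proof.
move=> u0; have h0 := height_gt0 u0; have s0 := sqrt1D_gt0 u.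
have d1 : is_derive u 1 (fun t => 1 - disc_radius t ^+ 2)
    (2 * disc_radius u ^+ 2 / Num.sqrt (1 + u ^+ 2)).
  have d0 := is_derive_disc_radius u.
  have -> : (fun t => 1 - disc_radius t ^+ 2) =
      cst 1 - disc_radius * disc_radius :> (R -> R).
    by apply/funext => t; rewrite !fctE expr2.
  have dM := is_deriveM d0 d0.
  have dB := is_deriveB (is_derive_cst (1 : R) u 1) dM.
  apply: (is_derive_eq dB).
  by rewrite /GRing.scale/=; field; rewrite gt_eqF.
have d2 : is_derive (1 - disc_radius u ^+ 2) 1 Num.sqrt (2 * height u)^-1.
  by apply: is_derive1_sqrt; rewrite -sqrtr_gt0.
have d3 := @is_derive1_comp _ Num.sqrt
  (fun t => 1 - disc_radius t ^+ 2) u _ _ d2 d1.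
apply: (is_derive_eq d3).
by field; rewrite !gt_eqF.
Qed.

Lemma sphere_chart e x : 0 <= x 0 1 -> sphere (chart e x).
Proof.
move=> u0; rewrite /sphere/= vec3_0 vec3_1 vec3_2.
rewrite !exprMn sqrr_sign mul1r sqr_height//.
have := cos2Dsin2 (x 0 0); set c := cos _; set s := sin _ => E.
have -> : s ^+ 2 = 1 - c ^+ 2 by lra.
by ring.
Qed.

Lemma continuous_chart e : continuous (chart e).
Proof.
move=> x.
have ru : {for x, continuous (fun y : 'rV[R]_2 => disc_radius (y 0 1))}.
  by apply: continuous_comp;
    [exact: coord_continuous|exact: continuous_disc_radius].
have c1 : {for x, continuous
    (fun y : 'rV[R]_2 => disc_radius (y 0 1) * cos (y 0 0))}.
  apply: (continuousM ru).
  by apply: continuous_comp; [exact: coord_continuous|exact: continuous_cos].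
have c2 : {for x, continuous
    (fun y : 'rV[R]_2 => disc_radius (y 0 1) * sin (y 0 0))}.
  apply: (continuousM ru).
  by apply: continuous_comp; [exact: coord_continuous|exact: continuous_sin].
have c3 : {for x, continuous (fun y : 'rV[R]_2 => (-1) ^+ e * height (y 0 1))}.
  apply: (@continuousM _ _ (cst ((-1) ^+ e))
    (fun y : 'rV[R]_2 => height (y 0 1))).
    exact: cst_continuous.
  by apply: continuous_comp; [exact: coord_continuous|exact: continuous_height].
exact: vec3_cvg c1 c2 c3.
Qed.

Lemma open_upper : open [set x : 'rV[R]_2 | 0 < x 0 1].
Proof.
apply: (@open_comp _ _ (fun x : 'rV[R]_2 => x 0 1) [set r | 0 < r]).
  by move=> x _; exact: coord_continuous.
exact: open_gt.
Qed.

(** For u > 0 both radicands, 1 + u^2 and 1 - r^2, are positive; the second vanishes on the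
    equator. *)
Lemma smooth_chart e : smooth_on [set x : 'rV[R]_2 | 0 < x 0 1] (chart e).
Proof.
move=> k; have oU := open_upper; set U := (X in Ck k X).
pose u (x : 'rV[R]_2) : R := x 0 1; pose phi (x : 'rV[R]_2) : R := x 0 0.
have Cu : Ck k U u by exact: Ck_coord.
have Cphi : Ck k U phi by exact: Ck_coord.
have C1 := Ck_cst oU k (1 : R); have CN1 := Ck_cst oU k (-1 : R).
have Cr : Ck k U (disc_radius \o u).
  have Cs := CkD oU C1 (CkM oU Cu Cu).
  have -> : disc_radius \o u = (Num.sqrt \o (cst 1 + u * u)) + cst (-1) * u.
    by apply/funext => x; rewrite !fctE/= mulN1r /disc_radius expr2.
  apply: CkD => //; last exact: CkM.
  apply: Ck_sqrt => // x _; rewrite !fctE/= -expr2.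
  by rewrite ltr_wpDr ?sqr_ge0.
have [Ccos Csin] := Ck_cos_sin oU Cphi.
have Ch : Ck k U (height \o u).
  have -> : height \o u = Num.sqrt \o
      (cst 1 + cst (-1) * ((disc_radius \o u) * (disc_radius \o u))).
    by apply/funext => x; rewrite !fctE/= mulN1r /height expr2.
  apply: Ck_sqrt => //; last first.
    have Crr := CkM oU Cr Cr; have CNrr := CkM oU CN1 Crr.
    exact: (CkD oU C1 CNrr).
  by move=> x Ux; rewrite !fctE/= mulN1r -expr2 -sqrtr_gt0; exact: height_gt0.
have Crc := CkM oU Cr Ccos; have Crs := CkM oU Cr Csin.
have Ceh := CkM oU (Ck_cst oU k ((-1) ^+ e : R)) Ch.
exact: (Ck_vec3 oU Crc Crs Ceh).
Qed.

(** Everything is expressed through dr, the last coordinate being the differential - r dr / h of h =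
    sqrt (1 - r^2), so that the metric comparison becomes algebraic. *)
Lemma derive_chart e x w : 0 < x 0 1 ->
  let u := x 0 1 in let r := disc_radius u in
  let dr := - r / Num.sqrt (1 + u ^+ 2) * w 0 1 in
  'D_w (chart e) x = vec3 (dr * cos (x 0 0) - r * sin (x 0 0) * w 0 0)
    (dr * sin (x 0 0) + r * cos (x 0 0) * w 0 0)
    ((-1) ^+ e * (- r * dr / height u)).
Proof.
move=> x0 u r dr.
pose U (x : 'rV[R]_2) : R := x 0 1; pose Phi (x : 'rV[R]_2) : R := x 0 0.
have dU : differentiable U x by exact: differentiable_coord.
have dPhi : differentiable Phi x by exact: differentiable_coord.
have [dR DR] := derive_comp1 w dU (is_derive_disc_radius u).
have [dC DC] := derive_comp1 w dPhi (is_derive_cos _).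
have [dS DS] := derive_comp1 w dPhi (is_derive_sin _).
have [dH DH] := derive_comp1 w dU (is_derive_height x0).
rewrite derive_coord in DR DH; rewrite derive_coord in DC DS.
have /= [dP _] := smooth_chart e 1.
rewrite derive_mx; last exact/diff_derivable/dP.
apply: rV3P; rewrite mxE ?(vec3_0, vec3_1, vec3_2).
- under eq_fun do rewrite vec3_0.
  rewrite (@deriveM _ _ (disc_radius \o U) (cos \o Phi));
    try exact: diff_derivable.
  rewrite DR DC /GRing.scale/= -/u -/r /Phi /dr; ring.
- under eq_fun do rewrite vec3_1.
  rewrite (@deriveM _ _ (disc_radius \o U) (sin \o Phi));
    try exact: diff_derivable.
  rewrite DR DS /GRing.scale/= -/u -/r /Phi /dr; ring.
- under eq_fun do rewrite vec3_2.
  rewrite (@deriveZ _ _ _ (height \o U)); try exact: diff_derivable.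
  rewrite DH /GRing.scale/= -/u -/r /dr.
  by field; rewrite !gt_eqF ?height_gt0 ?sqrt1D_gt0.
Qed.

Lemma chart_pole e phi : chart e (pt phi u) @[u --> +oo] --> pole e.
Proof.
rewrite /chart; under eq_fun do rewrite pt_0 pt_1.
have r0 := @disc_radius_cvg0 R.
(* The coordinates of the pole are written as products, matching the products of limits coordinate
   by coordinate. *)
rewrite /pole -[X in vec3 X _ _](mul0r (cos phi)).
rewrite -[X in vec3 _ X _](mul0r (sin phi)).
rewrite -[X in vec3 _ _ X]mulr1.
apply: vec3_cvg; apply: cvgM => //; try exact: cvg_cst.
exact: height_cvg1.
Qed.

End Chart.

(** * Injectivity of the charts and covering of the sphere *)

Section Cover.
Variable R : realType.
Implicit Types (q : 'rV[R]_3) (x y w : 'rV[R]_2) (e : bool).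

Lemma disc_polar_inj (r r' c s c' s' : R) : 0 < r -> 0 < r' ->
  c ^+ 2 + s ^+ 2 = 1 -> c' ^+ 2 + s' ^+ 2 = 1 ->
  r * c = r' * c' -> r * s = r' * s' -> [/\ r = r', c = c' & s = s'].
Proof.
move=> r0 r'0 cs cs' ec es.
have rr' : r ^+ 2 = r' ^+ 2.
  rewrite -[LHS]mulr1 -[RHS]mulr1 -{1}cs -cs' !mulrDr -!exprMn.
  by rewrite ec es.
have E : r = r' by apply/eqP; rewrite -(@eqrXn2 _ 2) ?rr' ?ltW.
move: ec es; rewrite -E => /(mulfI (lt0r_neq0 r0)) ->.
by move=> /(mulfI (lt0r_neq0 r0)) ->.
Qed.

(** Polar coordinates in the unit disc determine the point [x]; the sign of the third coordinate
    then determines the hemisphere unless the height is 0. Taking [e] and [e'] arbitrary covers both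
    injectivity and gluing. *)
Lemma chart_inj e e' x y : strip x -> strip y -> chart e x = chart e' y ->
  x = y /\ (e = e' \/ x 0 1 = 0).
Proof.
move=> [x0 x1] [y0 y1] E.
have /(congr1 (fun q : 'rV_3 => q 0 0)) := E; rewrite !vec3_0 => E0.
have /(congr1 (fun q : 'rV_3 => q 0 1)) := E; rewrite !vec3_1 => E1.
have /(congr1 (fun q : 'rV_3 => q 0 2)) := E; rewrite !vec3_2 => E2.
have [/disc_radius_inj eu ec es] := disc_polar_inj (disc_radius_gt0 _)
  (disc_radius_gt0 _) (cos2Dsin2 _) (cos2Dsin2 _) E0 E1.
split; first by apply: rV2P => //; exact: cos_sin_inj.
have [u0|] := ltP 0 (x 0 1); last by right; apply/le_anti/andP.
left; have := height_gt0 u0; move: E2; rewrite -eu.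
by case: e e' {E} => -[]//; rewrite ?expr1 ?expr0 => ? ?; exfalso; lra.
Qed.

Lemma chart_neq_pole e e' x : chart e x <> pole R e'.
Proof.
move=> E.
have /(congr1 (fun q : 'rV_3 => q 0 0)) := E; rewrite !vec3_0 => E0.
have /(congr1 (fun q : 'rV_3 => q 0 1)) := E; rewrite !vec3_1 => E1.
have r0 := lt0r_neq0 (disc_radius_gt0 (x 0 1)).
have c0 : cos (x 0 0) = 0 by apply: (mulfI r0); rewrite mulr0.
have s0 : sin (x 0 0) = 0 by apply: (mulfI r0); rewrite mulr0.
have := cos2Dsin2 (x 0 0); rewrite s0 c0 expr0n addr0 => /eqP.
by rewrite eq_sym oner_eq0.
Qed.

Lemma sphere_cover q : sphere q ->
  (exists e, q = pole R e) \/ (exists e x, strip x /\ q = chart e x).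
Proof.
rewrite /sphere/=; set a := q 0 0; set b := q 0 1; set c := q 0 2 => E.
(* The hemisphere is chosen by the sign of c; the equator c = 0 falls to [e = false]. *)
have cE : c = (-1) ^+ (c < 0)%R * `|c| by rewrite -numEsign.
have [ab|ab] := leP (a ^+ 2 + b ^+ 2) 0.
  left; exists (c < 0).
  apply: rV3P; rewrite ?(vec3_0, vec3_1, vec3_2) -/a -/b -/c.
  - by nra.
  - by nra.
  - rewrite [LHS]cE (_ : `|c| = 1) ?mulr1//.
    apply/eqP; rewrite -(@eqrXn2 _ 2)// real_normK ?num_real// expr1n.
    by apply/eqP; nra.
right; pose r := Num.sqrt (a ^+ 2 + b ^+ 2).
have r0 : 0 < r by rewrite sqrtr_gt0.
have rE : r ^+ 2 = a ^+ 2 + b ^+ 2 by rewrite sqr_sqrtr// ltW.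
have r1 : 0 < r <= 1 by rewrite r0/=; nra.
have [u u0 ur] := disc_radius_surj r1.
have [|phi phib [ca sb]] := @exists_angle _ (a / r) (b / r).
  by rewrite !exprMn -mulrDl -rE -exprMn mulfV ?expr1n// gt_eqF.
exists (c < 0), (pt phi u); split; first by split; rewrite ?pt_0 ?pt_1.
apply: rV3P; rewrite ?(vec3_0, vec3_1, vec3_2) ?pt_0 ?pt_1 -/a -/b -/c
  ?ur -?ca -?sb.
- by field; rewrite gt_eqF.
- by field; rewrite gt_eqF.
- rewrite [LHS]cE /height ur rE (_ : 1 - _ = c ^+ 2) ?sqrtr_sqr//.
  by rewrite -E; ring.
Qed.

End Cover.

(** * Comparison of the two systems *)

Section System.
Variable R : realType.
Implicit Types (q v : 'rV[R]_3).

Definition double_koval : system R := System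
  (fun q => 2 *: metric (kovalevskaya R) q)
  (fun q => 2^-1 * potential (kovalevskaya R) q).

Lemma bil_scale c (g : 'M[R]_3) v v' : bil (c *: g) v v' = c * bil g v v'.
Proof. by rewrite /bil -scalemxAr -scalemxAl mxE. Qed.

(** The diagonal entries 1, 1, 2 and the denominator are positive. Besides positivity of the metric,
    this gives the nondegeneracy that determines a vector from its covector. *)
Lemma bil_koval_gt0 q v : sphere q -> v != 0 ->
  0 < bil (metric (kovalevskaya R) q) v v.
Proof.
move=> Sq v0; rewrite bil_koval mulr_gt0 ?invr_gt0 ?koval_den_gt0//.
rewrite lt_neqAle; apply/andP; split; last by nra.
apply: contraNneq v0 => E.
by apply/eqP; apply: rV3P; rewrite mxE; nra.
Qed.

Lemma conservative_double_koval : conservative double_koval.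
Proof.
have openO := @open_koval_den R; set O := (X in open X) in openO.
have subO : @sphere R `<=` O by move=> q; exact: koval_den_gt0.
split.
- exists O; split=> // k.
  have C1 : Ck k O (fun q => 2 * (koval_den q)^-1).
    apply: (@CkM _ _ _ openO _ (cst 2) (GRing.inv \o @koval_den R)).
      exact: Ck_cst.
    apply: CkV => //; last exact: Ck_koval_den.
    by move=> q; rewrite /O/= => /gt_eqF->.
  have -> : metric double_koval = fun q => (2 * (koval_den q)^-1) *:
      diag_mx (\row_(i < 3) (if i == 2 then 2 else 1)).
    by apply/funext => q; rewrite /= scalerA.
  exact: CkZl.
- exists O; split=> // k.
  have -> : potential double_koval = cst (- 2^-1) * (fun q => q 0 0).
    by apply/funext => q; rewrite !fctE/= mulrN mulNr.
  by apply: CkM => //; [exact: Ck_cst|exact: Ck_coord].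
- move=> q _; rewrite /=. by rewrite linearZ/= linearZ/= tr_diag_mx.
- by move=> q v Sq _ v0; rewrite bil_scale mulr_gt0// bil_koval_gt0.
Qed.

Lemma corresponds_double_koval : corresponds double_koval (kovalevskaya R).
Proof.
exists id, 2^-1; split; first by rewrite invr_gt0.
  have sid : smooth_near_sphere (@id 'rV[R]_3).
    by exists setT; split=> // [|k]; [exact: openT|exact: Ck_id openT].
  by exists id; split.
move=> q v v' Sq Tv Tv' H.
(* Once v' = 2 v, both sides equal g(v, v) + U / 2, with g the metric and U the potential of
   [kovalevskaya]. *)
suff -> : v' = 2 *: v.
  rewrite /hamiltonian bil_scale !bil_koval !mxE /=; field.
  by rewrite gt_eqF// koval_den_gt0.
apply/eqP; rewrite -subr_eq0; apply/negPn/negP => n0.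
(* The covector premise is tested on the tangent vector w = v' - 2 v itself; it yields g(w, w) = 0,
   against positivity. *)
have Tw : tangent q (v' - 2 *: v).
  move: Tv Tv'; rewrite /tangent/= linearB/= linearZ/= mulmxBr -scalemxAr.
  by rewrite !mxE => -> ->; rewrite mulr0 subrr.
have Hw : bil (metric (kovalevskaya R) q) v' (v' - 2 *: v) =
    2 * bil (metric (kovalevskaya R) q) v (v' - 2 *: v).
  by rewrite -bil_scale -(H _ Tw) derive_id.
have := bil_koval_gt0 Sq n0; move: Hw.
by rewrite !bil_koval !mxE; lra.
Qed.

(** This is the pullback of the doubled metric as an identity between numbers: [c] and [t] stand for
    cos phi and sin phi, [sg] for the sign of the hemisphere, [s] for sqrt (1 + u^2), and [u * s]
    for the root of the quartic. *)
Lemma disc_metric (r u h c t sg w0 w1 : R) : 0 < r -> 0 < u -> 0 < h ->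
  1 - r ^+ 2 = 2 * u * r -> h ^+ 2 = 1 - r ^+ 2 -> c ^+ 2 + t ^+ 2 = 1 ->
  sg ^+ 2 = 1 ->
  let s := r + u in let dr := - r / s * w1 in
  2 * ((2 * (r * c) ^+ 2 + 2 * (r * t) ^+ 2 + (sg * h) ^+ 2)^-1 *
    ((dr * c - r * t * w0) * (dr * c - r * t * w0) +
     (dr * t + r * c * w0) * (dr * t + r * c * w0) +
     2 * ((sg * (- r * dr / h)) * (sg * (- r * dr / h))))) =
  (u * s - u ^+ 2 + 0) / (u * s) * (w0 ^+ 2 + (u * s)^-1 * w1 ^+ 2).
Proof.
move=> r0 u0 h0 r1 h2 ct sg2 s dr; have s0 : 0 < s by rewrite addr_gt0.
(* The denominator is 1 + r^2, and 1 - r^2 = 2 u r turns it into 2 r (u + r). *)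
have -> : 2 * (r * c) ^+ 2 + 2 * (r * t) ^+ 2 + (sg * h) ^+ 2 = 2 * s * r.
  rewrite !exprMn sg2 h2 mul1r (_ : t ^+ 2 = 1 - c ^+ 2);
    last by rewrite -ct; ring.
  by rewrite /s; lra.
have -> : (dr * c - r * t * w0) * (dr * c - r * t * w0) +
    (dr * t + r * c * w0) * (dr * t + r * c * w0) = dr ^+ 2 + r ^+ 2 * w0 ^+ 2.
  transitivity ((dr ^+ 2 + r ^+ 2 * w0 ^+ 2) * (c ^+ 2 + t ^+ 2)).
    by ring.
  by rewrite ct mulr1.
have -> : sg * (- r * dr / h) * (sg * (- r * dr / h)) = r * dr ^+ 2 / (2 * u).
  transitivity (sg ^+ 2 * (r ^+ 2 * dr ^+ 2) / h ^+ 2).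
    by field; rewrite gt_eqF.
  by rewrite sg2 h2 r1; field; rewrite !gt_eqF.
(* Both sides equal (r / s) (w0^2 + w1^2 / (u s)), using s - u = r and 1 + r / u = s / u. *)
rewrite /dr /s; field.
by rewrite !gt_eqF.
Qed.

Lemma sqrt_quartic (u : R) : 0 <= u ->
  Num.sqrt (quartic 1 0 u) = u * Num.sqrt (1 + u ^+ 2).
Proof.
move=> u0; rewrite (_ : quartic _ _ _ = u ^+ 2 * (1 + u ^+ 2)).
  by rewrite sqrtrM ?sqr_ge0// sqrtr_sqr ger0_norm.
by rewrite /quartic; ring.
Qed.

Lemma defines_double_koval : defines_on_sphere (Hp 1 0 0) double_koval.
Proof.
exists (@chart R), (@pole R); split.
- move=> e; split; last exact: smooth_chart.
  by apply: continuous_subspaceT; exact: continuous_chart.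
- move=> e phi u u0; rewrite /chart !pt_0 !pt_1 mulr_natl cosD2pi sinD2pi.
  by [].
- exact: chart_pole.
- split.
  + by move=> e x y Sx Sy /chart_inj[].
  + move=> x y Sx Sy; split.
      by move=> /chart_inj[]// -> [].
    (* On the equator the height is 0, so the sign that separates the two charts disappears. *)
    by move=> [<- x0]; rewrite /chart x0 height0 !mulr0.
  + move=> /(congr1 (fun q : 'rV_3 => q 0 2)); rewrite !vec3_2; lra.
  + by move=> e e' x _; exact: chart_neq_pole.
  + move=> q; split; first exact: sphere_cover.
    move=> [[e ->]|[e [x [[_ x1] ->]]]]; last exact: sphere_chart.
    by rewrite /sphere/= vec3_0 vec3_1 vec3_2 sqrr_sign expr0n !add0r.
- move=> e x x0; have r0 := disc_radius_gt0 (x 0 1).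
  have h0 := height_gt0 x0.
  have sA := sqrt_quartic (ltW x0).
  split.
  + move=> w; rewrite derive_chart// bil_scale bil_koval /koval_den /= sA.
    rewrite !(vec3_0, vec3_1, vec3_2).
    have sE : Num.sqrt (1 + x 0 1 ^+ 2) = disc_radius (x 0 1) + x 0 1.
      by rewrite /disc_radius subrK.
    rewrite sE; apply: disc_metric => //; last exact: sqrr_sign.
    * exact: onemX2_disc_radius.
    * exact: sqr_height (ltW x0).
    * exact: cos2Dsin2.
  + rewrite /= vec3_0 sA.
    have sE : Num.sqrt (1 + x 0 1 ^+ 2) = disc_radius (x 0 1) + x 0 1.
      by rewrite /disc_radius subrK.
    have r2 := onemX2_disc_radius (x 0 1).
    (* The factor 1 + 2 u^2 - 2 u s equals 1 - 2 u r = r^2, and the denominator 2 (u s - u^2) equals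
       2 u r; the quotient is r / 2. *)
    rewrite sE (_ : 1 + _ - _ = disc_radius (x 0 1) ^+ 2).
      field; rewrite mulrDr -expr2 addrK.
      by rewrite mulf_neq0 ?gt_eqF.
    transitivity (1 - 2 * x 0 1 * disc_radius (x 0 1)); first by ring.
    by rewrite -r2; ring.
Qed.

End System.

Unset Implicit Arguments.

Theorem theorem3p1 (R : realType) (a b p : R)
    (hb : b = 0) (ha : a = 1) (hp : p = 0) :
  exists S : system R,
    [/\ conservative S,
        defines_on_sphere (Hp a b p) S
      & corresponds S (kovalevskaya R)].
Proof.
rewrite hb ha hp; exists (double_koval R); split.
- exact: conservative_double_koval.
- exact: defines_double_koval.
- exact: corresponds_double_koval.
Qed.
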